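(* Let $\rho$ be a left-value-free constrained rewrite rule and let $\Pi X.\,s\,[\exists\vec{x}.\varphi]$ and $\Pi Y.\,t\,[\exists\vec{y}.\psi]$ be satisfiable existentially constrained terms. If $\Pi X.s[\exists\vec{x}.\varphi]\to_\rho\Pi X'.s'[\exists\vec{x}'.\varphi']$ and $\Pi X.s[\exists\vec{x}.\varphi]\sim\Pi Y.t[\exists\vec{y}.\psi]$, then there is an existentially constrained term $\Pi Y'.t'[\exists\vec{y}'.\psi']$ such that $\Pi Y.t[\exists\vec{y}.\psi]\to_\rho\Pi Y'.t'[\exists\vec{y}'.\psi']$ and $\Pi X'.s'[\exists\vec{x}'.\varphi']\sim\Pi Y'.t'[\exists\vec{y}'.\psi']$.
   Context: Fix a many-sorted signature whose sorts are partitioned into theory sorts and term sorts and whose function symbols are partitioned into theory symbols (all argument and result sorts are theory sorts) and term symbols; there is a theory sort $\mathsf{Bool}$. $\mathrm{Var}(t_1,\dots,t_n)$ is the set of variables in the $t_i$; $\mathrm{Pos}(s)$, $s|_p$, $s[u]_p$ as usual. A fixed model $\mathcal{M}$ interprets theory sorts by nonempty sets and theory symbols by functions, with $\mathsf{Bool}=\{\mathsf{true},\mathsf{false}\}$ and standard connectives and equalities; every element of every interpreted sort is a constant theory symbol, called a value; $\mathrm{Val}$ is the set of values and $\mathrm{Val}(\ell)$ the set of values occurring in $\ell$. A logical constraint is a $\mathsf{Bool}$-sorted term of theory symbols and variables; $\models_{\mathcal{M},\xi}\varphi$ (valuation $\xi$) and $\models_{\mathcal{M}}\varphi$ (all valuations)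 as usual. Substitutions are sort-preserving, $\mathrm{Dom}(\sigma)=\{x\mid\sigma(x)\ne x\}$, $\sigma$ is $X$-valued if $\sigma(X)\subseteq\mathrm{Val}$. Existential constraint $\exists\vec x.\varphi$: $\{\vec x\}\subseteq\mathrm{Var}(\varphi)$, $\mathrm{FVar}=\mathrm{Var}(\varphi)\setminus\{\vec x\}$; $\models_{\mathcal{M},\xi}\exists\vec x.\varphi$ iff some values $\vec v$ give $\models_{\mathcal{M},\xi}\varphi\{\vec x\mapsto\vec v\}$; valid/satisfiable: for all/some $\xi$. $\sigma\models_{\mathcal{M}}\exists\vec x.\varphi$ means $\sigma(\mathrm{FVar}(\exists\vec x.\varphi))\subseteq\mathrm{Val}$ and $\models_{\mathcal{M}}(\exists\vec x.\varphi)\sigma$. An existentially constrained term $\Pi X.s[\exists\vec x.\varphi]$ requires $\mathrm{FVar}(\exists\vec x.\varphi)\subseteq X\subseteq\mathrm{Var}(s)$ and $\{\vec x\}\cap\mathrm{Var}(s)=\emptyset$; satisfiable if its constraint is. Equivalence: $\Pi X.s[\exists\vec x.\varphi]\sim\Pi Y.t[\exists\vec y.\psi]$ iff for every $X$-valued $\sigma$ with $\sigma\models_{\mathcal{M}}\exists\vec x.\varphi$ there is a $Y$-valued $\gamma$ with $\gamma\models_{\mathcal{M}}\exists\vec y.\psi$ and $s\sigma=t\gamma$, and vice versa. A constrained rewrite rule $\rho:\Pi Z.\ell\to r[\pi]$: $\ell,r$ terms of the same sort, $\pi$ a logical constraint, $(\mathrm{Var}(r)\setminus\mathrm{Var}(\ell))\cup\mathrm{Var}(\pi)\subseteq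 Z\subseteq\mathrm{Var}(\ell,r,\pi)=\mathrm{Var}(\rho)$; left-linear if $\ell$ is linear; left-value-free if it is left-linear and $\mathrm{Val}(\ell)=\emptyset$; $\mathrm{ExVar}(\rho)=\mathrm{Var}(r)\setminus\mathrm{Var}(\ell)$. Most general rewrite step: for satisfiable $\Pi X.s[\exists\vec x.\varphi]$ and left-linear $\rho$ with $\mathrm{Var}(\rho)\cap\mathrm{Var}(s,\varphi)=\emptyset$, if $p\in\mathrm{Pos}(s)$ and $\gamma$ satisfy $\mathrm{Dom}(\gamma)=\mathrm{Var}(\ell)$, $s|_p=\ell\gamma$, $\gamma(x)\in\mathrm{Val}\cup X$ for all $x\in\mathrm{Var}(\ell)\cap Z$, and $\models_{\mathcal{M}}(\exists\vec x.\varphi)\Rightarrow(\exists\vec z.\pi\gamma)$ with $\{\vec z\}=\mathrm{Var}(\pi)\setminus\mathrm{Var}(\ell)$, then $\Pi X.s[\exists\vec x.\varphi]\to_\rho\Pi Y.t[\exists\vec y.\psi]$ with $t=s[r\gamma]_p$, $\psi=\varphi\land\pi\gamma$, $\{\vec y\}=\mathrm{Var}(\psi)\setminus\mathrm{Var}(t)$, $Y=\mathrm{ExVar}(\rho)\cup(X\cap\mathrm{Var}(t))$. Convention: rules are used with variables renamed apart, i.e. the variables of $\rho$ are assumed (after renaming $\rho$ if necessary) disjoint from those of every term it is applied to.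
   Formalization: The sets X, Y of the constrained terms and Z of the rule are required to contain only variables of theory sort; with a term-sorted variable in X no X-valued substitution exists, so equivalence holds vacuously and the claim fails. *)

(* Defs.v *)
From Stdlib Require Import List.
Import ListNotations.

Set Implicit Arguments.

(** * Signatures and models *)

(* Sorts are partitioned into theory sorts [T] and term sorts [U]. *)
Inductive sort_of_kind (T U : Type) : Type :=
| ThSort (s : T)
| TmSort (s : U).

(* Values are kept in their own type instead of being a subset of the theory
   symbols, so that [theory_symbol] lists the theory symbols that are not
   values.  The interpretation of a theory sort [s] is the fibre
   [{v : value | value_sort v = s}]; hence its elements are constants. *)
Record signature : Type := Signature {
  theory_sort : Type;
  term_sort : Type;
  sort := sort_of_kind theory_sort term_sort;
  bool_sort : theory_sort;

  value : Type;
  value_sort : value -> theory_sort;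

  theory_symbol : Type;
  theory_arity : theory_symbol -> list theory_sort;
  theory_result : theory_symbol -> theory_sort;

  term_symbol : Type;
  term_arity : term_symbol -> list sort;
  term_result : term_symbol -> sort;

  var : Type;
  var_sort : var -> sort;
  var_eq_dec : forall x y : var, {x = y} + {x <> y};
  var_infinite : forall (s : sort) (l : list var),
    exists x, var_sort x = s /\ ~ In x l;

  sym_not : theory_symbol;
  sym_and : theory_symbol;
  sym_or : theory_symbol;
  sym_imp : theory_symbol;
  sym_eq : theory_sort -> theory_symbol;
  sym_not_arity : theory_arity sym_not = [bool_sort];
  sym_not_result : theory_result sym_not = bool_sort;
  sym_and_arity : theory_arity sym_and = [bool_sort; bool_sort];
  sym_and_result : theory_result sym_and = bool_sort;
  sym_or_arity : theory_arity sym_or = [bool_sort; bool_sort];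
  sym_or_result : theory_result sym_or = bool_sort;
  sym_imp_arity : theory_arity sym_imp = [bool_sort; bool_sort];
  sym_imp_result : theory_result sym_imp = bool_sort;
  sym_eq_arity : forall s, theory_arity (sym_eq s) = [s; s];
  sym_eq_result : forall s, theory_result (sym_eq s) = bool_sort
}.

(* [interp f] is only meaningful on argument lists that fit the arity of [f]. *)
Record model (S : signature) : Type := Model {
  sort_inhabited : forall s : theory_sort S, exists v, value_sort S v = s;

  vtrue : value S;
  vfalse : value S;
  vtrue_neq_vfalse : vtrue <> vfalse;
  bool_values : forall v,
    value_sort S v = bool_sort S <-> v = vtrue \/ v = vfalse;

  interp : theory_symbol S -> list (value S) -> value S;
  interp_sort : forall f vs,
    map (value_sort S) vs = theory_arity S f ->
    value_sort S (interp f vs) = theory_result S f;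

  interp_not : forall v,
    value_sort S v = bool_sort S ->
    (interp (sym_not S) [v] = vtrue <-> v <> vtrue);
  interp_and : forall v w,
    value_sort S v = bool_sort S -> value_sort S w = bool_sort S ->
    (interp (sym_and S) [v; w] = vtrue <-> v = vtrue /\ w = vtrue);
  interp_or : forall v w,
    value_sort S v = bool_sort S -> value_sort S w = bool_sort S ->
    (interp (sym_or S) [v; w] = vtrue <-> v = vtrue \/ w = vtrue);
  interp_imp : forall v w,
    value_sort S v = bool_sort S -> value_sort S w = bool_sort S ->
    (interp (sym_imp S) [v; w] = vtrue <-> (v = vtrue -> w = vtrue));
  interp_eq : forall s v w,
    value_sort S v = s -> value_sort S w = s ->
    (interp (sym_eq S s) [v; w] = vtrue <-> v = w)
}.

(** * Terms *)

Inductive symbol (S : signature) : Type :=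
| ValSym (v : value S)
| ThSym (f : theory_symbol S)
| TmSym (f : term_symbol S).

Definition arity (S : signature) (f : symbol S) : list (sort S) :=
  match f with
  | ValSym _ _ => []
  | ThSym _ g => map (@ThSort _ _) (theory_arity S g)
  | TmSym _ g => term_arity S g
  end.

Definition result (S : signature) (f : symbol S) : sort S :=
  match f with
  | ValSym _ v => ThSort _ (value_sort S v)
  | ThSym _ g => ThSort _ (theory_result S g)
  | TmSym _ g => term_result S g
  end.

(* Raw terms; the terms of the signature are the [well_sorted] ones. *)
Inductive term (S : signature) : Type :=
| Var (x : var S)
| App (f : symbol S) (ts : list (term S)).

Definition val (S : signature) (v : value S) : term S := App (ValSym S v) [].

Definition term_sort_of (S : signature) (t : term S) : sort S :=
  match t with
  | Var _ x => var_sort S x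
  | App f _ => result f
  end.

Fixpoint well_sorted (S : signature) (t : term S) : Prop :=
  match t with
  | Var _ _ => True
  | App f ts =>
      map (@term_sort_of S) ts = arity f /\
      fold_right (fun u P => well_sorted u /\ P) True ts
  end.

(* Variables and values of a term, from left to right and with repetitions. *)
Fixpoint vars (S : signature) (t : term S) : list (var S) :=
  match t with
  | Var _ x => [x]
  | App _ ts => flat_map (@vars S) ts
  end.

Fixpoint vals (S : signature) (t : term S) : list (value S) :=
  match t with
  | Var _ _ => []
  | App f ts =>
      match f with ValSym _ v => [v] | _ => [] end ++ flat_map (@vals S) ts
  end.

Definition linear (S : signature) (t : term S) : Prop := NoDup (vars t).

Fixpoint no_term_symbol (S : signature) (t : term S) : Prop :=
  match t with
  | Var _ _ => True
  | App f ts =>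
      match f with TmSym _ _ => False | _ => True end /\
      fold_right (fun u P => no_term_symbol u /\ P) True ts
  end.

Definition theory_var (S : signature) (x : var S) : Prop :=
  exists s, var_sort S x = ThSort _ s.

(** Positions are lists of argument indices, counted from 0. *)

(* [None] when [p] is not a position of [t]. *)
Fixpoint subterm_at (S : signature) (t : term S) (p : list nat) :
    option (term S) :=
  match p with
  | [] => Some t
  | i :: q =>
      match t with
      | Var _ _ => None
      | App _ ts =>
          match nth_error ts i with
          | Some u => subterm_at u q
          | None => None
          end
      end
  end.

(* [t] itself when [p] is not a position of [t]. *)
Fixpoint replace_at (S : signature) (t : term S) (p : list nat) (u : term S) :
    term S :=
  match p with
  | [] => u
  | i :: q =>
      match t with
      | Var _ _ => t
      | App f ts =>
          match nth_error ts i with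
          | Some w =>
              App f (firstn i ts ++ replace_at w q u :: skipn (Datatypes.S i) ts)
          | None => t
          end
      end
  end.

(** * Substitutions *)

Record substitution (S : signature) : Type := Substitution {
  sub_fun :> var S -> term S;
  sub_well_sorted : forall x, well_sorted (sub_fun x);
  sub_sort : forall x, term_sort_of (sub_fun x) = var_sort S x
}.

Fixpoint apply (S : signature) (sigma : var S -> term S) (t : term S) :
    term S :=
  match t with
  | Var _ x => sigma x
  | App f ts => App f (map (apply sigma) ts)
  end.

Definition in_dom (S : signature) (sigma : var S -> term S) (x : var S) : Prop :=
  sigma x <> Var S x.

Definition is_val (S : signature) (t : term S) : Prop := exists v, t = val S v.

Definition valued (S : signature) (X : var S -> Prop)
    (sigma : var S -> term S) : Prop :=
  forall x, X x -> is_val (sigma x).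

(** * Logical and existential constraints *)

Definition logical_constraint (S : signature) (phi : term S) : Prop :=
  well_sorted phi /\
  term_sort_of phi = ThSort _ (bool_sort S) /\
  no_term_symbol phi.

Definition conj_constraint (S : signature) (phi psi : term S) : term S :=
  App (ThSym S (sym_and S)) [phi; psi].

(* Variables of a term sort never occur in a constraint, so their images are
   unconstrained. *)
Record valuation (S : signature) : Type := Valuation {
  valuation_fun :> var S -> value S;
  valuation_sort : forall x s,
    var_sort S x = ThSort _ s -> value_sort S (valuation_fun x) = s
}.

(* The [TmSym] case is a dummy: only theory terms are evaluated. *)
Fixpoint eval (S : signature) (M : model S) (xi : valuation S) (t : term S) :
    value S :=
  match t with
  | Var _ x => xi x
  | App f ts =>
      match f with
      | ValSym _ v => v
      | ThSym _ g => interp M g (map (eval M xi) ts)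
      | TmSym _ _ => vtrue M
      end
  end.

Definition holds (S : signature) (M : model S) (xi : valuation S)
    (phi : term S) : Prop :=
  eval M xi phi = vtrue M.

(* [EConstr xs phi] is [exists xs. phi]; only the set of elements of [xs]
   matters. *)
Record econstr (S : signature) : Type := EConstr {
  ex_vars : list (var S);
  ex_body : term S
}.

Definition is_econstr (S : signature) (c : econstr S) : Prop :=
  logical_constraint (ex_body c) /\
  incl (ex_vars c) (vars (ex_body c)).

Definition fvar (S : signature) (c : econstr S) (x : var S) : Prop :=
  In x (vars (ex_body c)) /\ ~ In x (ex_vars c).

(* The substitution [{xs |-> w(xs)}]. *)
Definition assign (S : signature) (xs : list (var S)) (w : var S -> value S)
    (x : var S) : term S :=
  if in_dec (var_eq_dec S) x xs then val S (w x) else Var S x.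

Definition ex_holds (S : signature) (M : model S) (xi : valuation S)
    (c : econstr S) : Prop :=
  exists w : var S -> value S,
    (forall x, In x (ex_vars c) -> var_sort S x = ThSort _ (value_sort S (w x))) /\
    holds M xi (apply (assign S (ex_vars c) w) (ex_body c)).

Definition ex_valid (S : signature) (M : model S) (c : econstr S) : Prop :=
  forall xi : valuation S, ex_holds M xi c.

Definition ex_satisfiable (S : signature) (M : model S) (c : econstr S) : Prop :=
  exists xi : valuation S, ex_holds M xi c.

Definition ex_entails (S : signature) (M : model S) (c d : econstr S) : Prop :=
  forall xi : valuation S, ex_holds M xi c -> ex_holds M xi d.

(* Bound variables are left alone.  There is no renaming of bound variables:
   this is only used when [sigma] maps the free variables to values. *)
Definition ex_apply (S : signature) (sigma : var S -> term S) (c : econstr S) :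
    econstr S :=
  EConstr (ex_vars c)
    (apply
       (fun x => if in_dec (var_eq_dec S) x (ex_vars c) then Var S x
                 else sigma x)
       (ex_body c)).

Definition satisfies (S : signature) (M : model S) (sigma : var S -> term S)
    (c : econstr S) : Prop :=
  valued (fvar c) sigma /\ ex_valid M (ex_apply sigma c).

(** * Existentially constrained terms *)

(* The set [X] consists of variables of theory sorts, as only those can be
   instantiated by values. *)
Record ecterm (S : signature) : Type := ECTerm {
  ec_logical : var S -> Prop;
  ec_term : term S;
  ec_constr : econstr S;
  ec_well_sorted : well_sorted ec_term;
  ec_is_econstr : is_econstr ec_constr;
  ec_logical_theory : forall x, ec_logical x -> theory_var S x;
  ec_fvar_logical : forall x, fvar ec_constr x -> ec_logical x;
  ec_logical_term : forall x, ec_logical x -> In x (vars ec_term);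
  ec_bound_fresh : forall x, In x (ex_vars ec_constr) -> ~ In x (vars ec_term)
}.

Definition satisfiable (S : signature) (M : model S) (A : ecterm S) : Prop :=
  ex_satisfiable M (ec_constr A).

Definition subsumed (S : signature) (M : model S) (A B : ecterm S) : Prop :=
  forall sigma : substitution S,
    valued (ec_logical A) sigma -> satisfies M sigma (ec_constr A) ->
    exists gamma : substitution S,
      valued (ec_logical B) gamma /\ satisfies M gamma (ec_constr B) /\
      apply sigma (ec_term A) = apply gamma (ec_term B).

Definition equivalent (S : signature) (M : model S) (A B : ecterm S) : Prop :=
  subsumed M A B /\ subsumed M B A.

(** * Constrained rewrite rules *)

Record rule (S : signature) : Type := Rule {
  rl_logical : var S -> Prop;
  rl_lhs : term S;
  rl_rhs : term S;
  rl_guard : term S;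
  rl_lhs_well_sorted : well_sorted rl_lhs;
  rl_rhs_well_sorted : well_sorted rl_rhs;
  rl_same_sort : term_sort_of rl_lhs = term_sort_of rl_rhs;
  rl_guard_constraint : logical_constraint rl_guard;
  rl_logical_theory : forall x, rl_logical x -> theory_var S x;
  rl_extra_logical : forall x,
    (In x (vars rl_rhs) /\ ~ In x (vars rl_lhs)) \/ In x (vars rl_guard) ->
    rl_logical x;
  rl_logical_vars : forall x, rl_logical x ->
    In x (vars rl_lhs) \/ In x (vars rl_rhs) \/ In x (vars rl_guard)
}.

Definition rule_var (S : signature) (rho : rule S) (x : var S) : Prop :=
  In x (vars (rl_lhs rho)) \/ In x (vars (rl_rhs rho)) \/
  In x (vars (rl_guard rho)).

Definition exvar (S : signature) (rho : rule S) (x : var S) : Prop :=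
  In x (vars (rl_rhs rho)) /\ ~ In x (vars (rl_lhs rho)).

Definition left_linear (S : signature) (rho : rule S) : Prop :=
  linear (rl_lhs rho).

Definition left_value_free (S : signature) (rho : rule S) : Prop :=
  left_linear rho /\ vals (rl_lhs rho) = [].

Definition apart (S : signature) (rho : rule S) (A : ecterm S) : Prop :=
  forall x, rule_var rho x ->
    ~ In x (vars (ec_term A)) /\ ~ In x (vars (ex_body (ec_constr A))).

(* [rho'] is [rho] up to a sort-preserving bijective renaming of variables. *)
Definition variant (S : signature) (rho rho' : rule S) : Prop :=
  exists delta delta_inv : var S -> var S,
    (forall x, delta_inv (delta x) = x) /\
    (forall x, delta (delta_inv x) = x) /\
    (forall x, var_sort S (delta x) = var_sort S x) /\
    rl_lhs rho' = apply (fun x => Var S (delta x)) (rl_lhs rho) /\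
    rl_rhs rho' = apply (fun x => Var S (delta x)) (rl_rhs rho) /\
    rl_guard rho' = apply (fun x => Var S (delta x)) (rl_guard rho) /\
    (forall x, rl_logical rho' (delta x) <-> rl_logical rho x).

(** * Most general rewrite steps *)

Definition mg_step (S : signature) (M : model S) (rho : rule S)
    (A B : ecterm S) : Prop :=
  satisfiable M A /\ left_linear rho /\ apart rho A /\
  exists (p : list nat) (gamma : substitution S) (zs : list (var S)),
    (forall x, in_dom gamma x <-> In x (vars (rl_lhs rho))) /\
    subterm_at (ec_term A) p = Some (apply gamma (rl_lhs rho)) /\
    (forall x, In x (vars (rl_lhs rho)) -> rl_logical rho x ->
       is_val (gamma x) \/ exists y, ec_logical A y /\ gamma x = Var S y) /\
    (forall z, In z zs <->
       In z (vars (rl_guard rho)) /\ ~ In z (vars (rl_lhs rho))) /\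
    ex_entails M (ec_constr A) (EConstr zs (apply gamma (rl_guard rho))) /\
    ec_term B = replace_at (ec_term A) p (apply gamma (rl_rhs rho)) /\
    ex_body (ec_constr B) =
      conj_constraint (ex_body (ec_constr A)) (apply gamma (rl_guard rho)) /\
    (forall y, In y (ex_vars (ec_constr B)) <->
       In y (vars (ex_body (ec_constr B))) /\ ~ In y (vars (ec_term B))) /\
    (forall y, ec_logical B y <->
       exvar rho y \/ (ec_logical A y /\ In y (vars (ec_term B)))).

(* Main.v *)
(** Instantiate the logical variables of [B] by values satisfying its constraint
    and leave all other variables alone.  Such a substitution [tau] creates no
    new redex of a left-linear, value-free left-hand side, and by equivalence
    [apply tau t] is an instance of [s].  Hence the redex of [s] at [p] is
    already present in [t] at [p]: the matcher [gamma'] is read off [t], and its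
    images of logical variables are values or logical variables because [tau]
    sends them to values.  Given [gamma], [gamma'] at the same position,
    [apply sigma s = apply tau t] implies
    [apply sigma (gamma x) = apply tau (gamma' x)] for [x] in the left-hand side,
    so the guards agree on [sigma] and [tau]; transporting [sigma] along the
    renaming on the extra variables of the rule then turns common instances of
    [s], [t] into common instances of the contracta. *)

From Stdlib Require Import List Classical ClassicalEpsilon.
Require Import Defs.
Import ListNotations.

Set Implicit Arguments.

Lemma NoDup_app_disjoint (T : Type) (l l' : list T) :
  NoDup (l ++ l') -> forall x, In x l -> In x l' -> False.
Proof.
  intros H x Hx Hx'. apply in_split in Hx as (l1 & l2 & ->).
  rewrite <- app_assoc in H. apply NoDup_remove_2 in H.
  apply H. rewrite !in_app_iff. auto.
Qed.

(** * Terms, sorts and substitutions *)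

Section Terms.
Variable S : signature.
Implicit Types (t u v : term S) (p q : list nat) (g h : var S -> term S).

(** Arguments sit in a list, so the hypothesis is needed for every element of it; the inner
    induction on the list keeps the [fix] call guarded. *)
Lemma term_nested_ind (P : term S -> Prop) :
  (forall x, P (Var S x)) ->
  (forall f ts, Forall P ts -> P (App f ts)) ->
  forall t, P t.
Proof.
  intros HV HA. fix IH 1. intros [x | f ts].
  - apply HV.
  - apply HA. induction ts as [|t ts IHts]; constructor; [apply IH | exact IHts].
Qed.

Lemma fold_right_Forall (T : Type) (P : T -> Prop) (l : list T) :
  fold_right (fun (a : T) Q => P a /\ Q) True l <-> Forall P l.
Proof.
  induction l as [|a l IH]; simpl.
  - split; auto.
  - rewrite IH, Forall_cons_iff. reflexivity.
Qed.

Lemma well_sorted_App f (ts : list (term S)) :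
  well_sorted (App f ts) <->
  map (@term_sort_of S) ts = arity f /\ Forall (@well_sorted S) ts.
Proof. simpl. rewrite fold_right_Forall. reflexivity. Qed.

Lemma no_term_symbol_App f (ts : list (term S)) :
  no_term_symbol (App f ts) <->
  match f with TmSym _ _ => False | _ => True end /\
  Forall (@no_term_symbol S) ts.
Proof. simpl. rewrite fold_right_Forall. reflexivity. Qed.

(** The forward direction extracts the images of variables from a matching equation; the backward
    one rebuilds terms from them. *)
Lemma apply_eq_iff g h t :
  apply g t = apply h t <-> (forall x, In x (vars t) -> g x = h x).
Proof.
  induction t as [x | f ts IH] using term_nested_ind; simpl.
  - split; [intros E y [<- | []]; exact E | auto].
  - rewrite Forall_forall in IH. split.
    + intros E x (u & Hu & Hx)%in_flat_map.
      injection E as E. apply (proj1 (IH u Hu)); [|exact Hx].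
      exact (proj1 map_ext_in_iff E u Hu).
    + intros E. f_equal. apply map_ext_in. intros u Hu. apply IH; [exact Hu|].
      intros x Hx. apply E, in_flat_map. eauto.
Qed.

Lemma apply_Var t : apply (Var S) t = t.
Proof.
  induction t as [x | f ts IH] using term_nested_ind; simpl; [reflexivity|].
  f_equal. rewrite <- (map_id ts) at 2. apply map_ext_in.
  rewrite Forall_forall in IH. exact IH.
Qed.

Lemma apply_apply g h t :
  apply g (apply h t) = apply (fun x => apply g (h x)) t.
Proof.
  induction t as [x | f ts IH] using term_nested_ind; simpl; [reflexivity|].
  f_equal. rewrite map_map. apply map_ext_in.
  rewrite Forall_forall in IH. exact IH.
Qed.

Lemma in_vars_apply g t y :
  In y (vars (apply g t)) <-> exists x, In x (vars t) /\ In y (vars (g x)).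
Proof.
  induction t as [x | f ts IH] using term_nested_ind; simpl.
  - split; [eauto | intros (z & [<- | []] & H); exact H].
  - rewrite Forall_forall in IH. rewrite in_flat_map. split.
    + intros (u' & (u & <- & Hu)%in_map_iff & Hy).
      apply (IH u Hu) in Hy as (x & Hx & Hy).
      exists x. split; [apply in_flat_map; eauto | exact Hy].
    + intros (x & (u & Hu & Hx)%in_flat_map & Hy).
      exists (apply g u). split; [apply in_map; exact Hu|].
      apply (IH u Hu). eauto.
Qed.

Lemma vars_rename (d : var S -> var S) t :
  vars (apply (fun x => Var S (d x)) t) = map d (vars t).
Proof.
  induction t as [x | f ts IH] using term_nested_ind; simpl; [reflexivity|].
  induction IH as [|u us Hu _ IHus]; simpl; [reflexivity|].
  rewrite map_app, Hu, IHus. reflexivity.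
Qed.

Lemma term_sort_of_apply g t :
  (forall x, In x (vars t) -> term_sort_of (g x) = var_sort S x) ->
  term_sort_of (apply g t) = term_sort_of t.
Proof. destruct t; simpl; auto. Qed.

Lemma well_sorted_apply (sigma : substitution S) t :
  well_sorted t -> well_sorted (apply sigma t).
Proof.
  induction t as [x | f ts IH] using term_nested_ind; intros H.
  - apply sub_well_sorted.
  - apply well_sorted_App in H as [E H]. apply well_sorted_App. split.
    + rewrite <- E, map_map. apply map_ext. intros u.
      apply term_sort_of_apply. intros x _. apply sub_sort.
    + rewrite Forall_map. rewrite Forall_forall in *. auto.
Qed.

Lemma well_sorted_apply_inv g t x :
  well_sorted (apply g t) -> In x (vars t) -> well_sorted (g x).
Proof.
  induction t as [y | f ts IH] using term_nested_ind; intros H Hx.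
  - destruct Hx as [<- | []]. exact H.
  - simpl apply in H. apply well_sorted_App in H as [_ H].
    apply in_flat_map in Hx as (u & Hu & Hx).
    rewrite Forall_map in H. rewrite Forall_forall in *. eauto.
Qed.

Lemma no_term_symbol_apply g t :
  no_term_symbol t -> (forall x, In x (vars t) -> no_term_symbol (g x)) ->
  no_term_symbol (apply g t).
Proof.
  induction t as [x | f ts IH] using term_nested_ind; intros H Hg.
  - apply Hg. left. reflexivity.
  - apply no_term_symbol_App in H as [Hf H]. simpl apply.
    apply no_term_symbol_App. split; [exact Hf|].
    rewrite Forall_map. rewrite Forall_forall in *. intros u Hu.
    apply IH; auto. intros x Hx. apply Hg, in_flat_map. eauto.
Qed.

(** Without term symbols every argument sort comes from the arity of a theory symbol, so only the
    sort at the root has to be assumed. *)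
Lemma theory_term_vars t s :
  well_sorted t -> no_term_symbol t -> term_sort_of t = ThSort _ s ->
  forall x, In x (vars t) -> theory_var S x.
Proof.
  revert s. induction t as [y | f ts IH] using term_nested_ind;
    intros s Hw Hn Hs x Hx.
  - destruct Hx as [<- | []]. exists s. exact Hs.
  - apply well_sorted_App in Hw as [E Hw].
    apply no_term_symbol_App in Hn as [Hf Hn].
    apply in_flat_map in Hx as (u & Hu & Hx).
    rewrite Forall_forall in *.
    assert (In (term_sort_of u) (arity f)) as Ha
      by (rewrite <- E; apply in_map; exact Hu).
    destruct f as [w | k | k]; simpl in Ha; [contradiction | | contradiction].
    apply in_map_iff in Ha as (s' & Hs' & _). eauto.
Qed.

(** * Subterms and replacement at positions *)

Lemma subterm_at_apply g t p u :
  subterm_at t p = Some u ->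
  subterm_at (apply g t) p = Some (apply g u).
Proof.
  revert t. induction p as [|i q IH]; simpl; intros t H.
  - injection H as <-. reflexivity.
  - destruct t as [x | f ts]; [discriminate|]. simpl.
    rewrite nth_error_map. destruct (nth_error ts i); [simpl; auto | discriminate].
Qed.

Lemma subterm_at_vars t p u x :
  subterm_at t p = Some u -> In x (vars u) -> In x (vars t).
Proof.
  revert t. induction p as [|i q IH]; simpl; intros t H Hx.
  - injection H as <-. exact Hx.
  - destruct t as [y | f ts]; [discriminate|].
    destruct (nth_error ts i) as [w|] eqn:E; [|discriminate].
    apply in_flat_map. exists w. split; [eapply nth_error_In; eauto | eauto].
Qed.

Lemma subterm_at_well_sorted t p u :
  subterm_at t p = Some u -> well_sorted t -> well_sorted u.
Proof.
  revert t. induction p as [|i q IH]; intros t H Hw.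
  - injection H as <-. exact Hw.
  - destruct t as [y | f ts]; [discriminate|]. simpl in H.
    destruct (nth_error ts i) as [w|] eqn:E; [|discriminate].
    apply well_sorted_App in Hw as [_ Hw]. rewrite Forall_forall in Hw.
    eauto using nth_error_In.
Qed.

Lemma replace_at_split f (ts : list (term S)) i w :
  nth_error ts i = Some w ->
  exists l1 l2, ts = l1 ++ w :: l2 /\
    forall q u, replace_at (App f ts) (i :: q) u =
      App f (l1 ++ replace_at w q u :: l2).
Proof.
  intros E. simpl. rewrite E.
  apply nth_error_split in E as (l1 & l2 & -> & <-).
  exists l1, l2. split; [reflexivity|]. intros q u. f_equal. f_equal.
  - rewrite firstn_app, PeanoNat.Nat.sub_diag, firstn_all. simpl.
    apply app_nil_r.
  - f_equal. clear. induction l1; simpl; auto.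
Qed.

(** [p] must be a position of [t]: otherwise the left replacement does nothing, whereas
    instantiation may create [p] and let the right one take effect. *)
Lemma replace_at_apply g t p u v :
  subterm_at t p = Some u ->
  apply g (replace_at t p v) = replace_at (apply g t) p (apply g v).
Proof.
  revert t. induction p as [|i q IH]; simpl; intros t H; [reflexivity|].
  destruct t as [x | f ts]; [discriminate|]. simpl.
  rewrite nth_error_map. destruct (nth_error ts i); [simpl | discriminate].
  rewrite map_app, firstn_map. f_equal. f_equal. simpl. f_equal; [auto|].
  destruct ts; [reflexivity|]. symmetry. apply skipn_map.
Qed.

Lemma replace_at_vars t p u x :
  In x (vars (replace_at t p u)) -> In x (vars t) \/ In x (vars u).
Proof.
  revert t. induction p as [|i q IH]; intros t H; [right; exact H|].
  destruct t as [y | f ts]; [left; exact H|].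
  destruct (nth_error ts i) as [w|] eqn:E.
  - destruct (replace_at_split f ts i E) as (l1 & l2 & -> & Hr).
    rewrite Hr in H. simpl in *.
    rewrite flat_map_app, in_app_iff in *. simpl in *.
    rewrite in_app_iff in *.
    destruct H as [H | [H | H]]; auto. apply IH in H as [H | H]; auto.
  - simpl in H. rewrite E in H. auto.
Qed.

Lemma replace_at_vars_new t p u v x :
  subterm_at t p = Some u -> In x (vars v) -> In x (vars (replace_at t p v)).
Proof.
  revert t. induction p as [|i q IH]; intros t H Hx; [exact Hx|].
  destruct t as [y | f ts]; [discriminate|]. simpl in H.
  destruct (nth_error ts i) as [w|] eqn:E; [|discriminate].
  destruct (replace_at_split f ts i E) as (l1 & l2 & -> & Hr).
  rewrite Hr. simpl. rewrite flat_map_app, in_app_iff. simpl.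
  rewrite in_app_iff. eauto.
Qed.

Lemma replace_at_well_sorted t p u v :
  subterm_at t p = Some u -> well_sorted t -> well_sorted v ->
  term_sort_of v = term_sort_of u ->
  well_sorted (replace_at t p v) /\
  term_sort_of (replace_at t p v) = term_sort_of t.
Proof.
  intros H Ht Hv Hs. revert t H Ht. induction p as [|i q IH]; intros t H Ht.
  - injection H as ->. auto.
  - destruct t as [y | f ts]; [discriminate|]. simpl in H.
    destruct (nth_error ts i) as [w|] eqn:E; [|discriminate].
    destruct (replace_at_split f ts i E) as (l1 & l2 & -> & Hr).
    rewrite Hr. split; [|reflexivity].
    apply well_sorted_App in Ht as [Ea Ht].
    rewrite Forall_app, Forall_cons_iff in Ht. destruct Ht as (H1 & Hw & H2).
    destruct (IH w H Hw) as [IHw IHs].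
    apply well_sorted_App. split.
    + rewrite map_app in *. simpl in *. rewrite IHs. exact Ea.
    + rewrite Forall_app, Forall_cons_iff. auto.
Qed.

(** * Matching into instances by values *)

Definition flat g : Prop := forall x, is_val (g x) \/ g x = Var S x.

(* A flat substitution creates no proper subterms, so every position of [s] is
   already one of [t]. *)
Lemma subterm_at_flat g h (s t : term S) p u :
  flat h -> apply g s = apply h t -> subterm_at s p = Some u ->
  exists v, subterm_at t p = Some v /\ apply g u = apply h v.
Proof.
  intros Hh. revert s t. induction p as [|i q IH]; simpl; intros s t E H.
  - injection H as <-. eauto.
  - destruct s as [x | f ts]; [discriminate|].
    destruct (nth_error ts i) as [w|] eqn:Ew; [|discriminate].
    destruct t as [y | f' ts']; simpl in E.
    (* A variable [y] of [t] would have to become an application with an argument at [i], but [h y]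
       is a constant or a variable. *)
    + destruct (Hh y) as [[a Ha] | Ha]; rewrite Ha in E; [|discriminate].
      injection E as _ E. destruct ts; [destruct i; discriminate | discriminate].
    + injection E as _ E. apply (f_equal (fun l => nth_error l i)) in E.
      rewrite !nth_error_map, Ew in E. simpl in E.
      destruct (nth_error ts' i) as [w'|]; [|discriminate].
      injection E as E. eauto.
Qed.

(* Value-freeness excludes that a symbol of [l] is matched by a variable of [t]
   that [h] maps to a value. *)
Lemma linear_match_flat g h l t :
  flat h -> linear l -> vals l = [] -> apply g l = apply h t ->
  exists k, apply k l = t.
Proof.
  intros Hh. revert t.
  induction l as [x | f ls IH] using term_nested_ind; intros t Hl Hv E.
  - exists (fun _ => t). reflexivity.
  - destruct t as [y | f' ts]; simpl in E.
    { destruct (Hh y) as [[a Ha] | Ha]; rewrite Ha in E; [|discriminate].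
      injection E as -> _. discriminate. }
    injection E as -> E.
    assert (flat_map (@vals S) ls = []) as Hv'
      by (simpl in Hv; apply app_eq_nil in Hv; apply Hv).
    unfold linear in Hl. simpl in Hl.
    cut (exists k, map (apply k) ls = ts).
    { intros [k Hk]. exists k. simpl. rewrite Hk. reflexivity. }
    clear Hv f'. revert ts E. induction IH as [|l ls IHl _ IHls]; intros [|t ts] E;
      try discriminate.
    + exists (Var S). reflexivity.
    + simpl in *. injection E as E Es. apply app_eq_nil in Hv' as [Hv Hvs].
      destruct (IHl t) as [k1 Hk1]; auto.
      { apply NoDup_app_remove_r in Hl. exact Hl. }
      destruct (IHls) with (ts := ts) as [k2 Hk2]; auto.
      { apply NoDup_app_remove_l in Hl. exact Hl. }
      (* The matchers of head and tail are glued; by linearity no variable of the tail lies in [l],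
         so both keep their bindings. *)
      exists (fun x => if in_dec (var_eq_dec S) x (vars l) then k1 x else k2 x).
      f_equal.
      * rewrite <- Hk1. apply apply_eq_iff. intros x Hx.
        destruct (in_dec _ _ _); [reflexivity | contradiction].
      * rewrite <- Hk2. apply map_ext_in. intros u Hu.
        apply apply_eq_iff. intros x Hx.
        destruct (in_dec _ _ _) as [Hx'|]; [exfalso | reflexivity].
        assert (In x (flat_map (@vars S) ls)) as Hx'' by (apply in_flat_map; eauto).
        exact (NoDup_app_disjoint _ _ Hl x Hx' Hx'').
Qed.

(** * Gluing substitutions and valuations *)

Lemma substitution_splice (P : var S -> Prop) (sigma tau : substitution S) :
  exists theta : substitution S,
    (forall x, P x -> theta x = sigma x) /\
    (forall x, ~ P x -> theta x = tau x).
Proof.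
  unshelve eexists (Substitution
    (fun x => if excluded_middle_informative (P x) then sigma x else tau x) _ _).
  - intros x. simpl. destruct (excluded_middle_informative _);
      apply sub_well_sorted.
  - intros x. simpl. destruct (excluded_middle_informative _); apply sub_sort.
  - split; intros x Hx; simpl;
      destruct (excluded_middle_informative _); tauto.
Qed.

Lemma valuation_splice (P : var S -> Prop) (xi eta : valuation S) :
  exists theta : valuation S,
    (forall x, P x -> theta x = xi x) /\
    (forall x, ~ P x -> theta x = eta x).
Proof.
  unshelve eexists (Valuation
    (fun x => if excluded_middle_informative (P x) then xi x else eta x) _).
  - intros x s Hs. simpl. destruct (excluded_middle_informative _);
      apply valuation_sort; exact Hs.
  - split; intros x Hx; simpl;
      destruct (excluded_middle_informative _); tauto.
Qed.

(** A valuation has prescribed sorts only at variables of theory sorts, so [P] is restricted to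
    those. *)
Lemma substitution_ground (P : var S -> Prop) (e : valuation S)
    (sigma : substitution S) :
  (forall x, P x -> theory_var S x) ->
  exists theta : substitution S,
    (forall x, P x -> theta x = val S (e x)) /\
    (forall x, ~ P x -> theta x = sigma x).
Proof.
  intros HP. unshelve eexists (Substitution
    (fun x => if excluded_middle_informative (P x) then val S (e x)
              else sigma x) _ _).
  - intros x. simpl. destruct (excluded_middle_informative _);
      [simpl; auto | apply sub_well_sorted].
  - intros x. simpl. destruct (excluded_middle_informative _) as [Hx|];
      [|apply sub_sort].
    destruct (HP x Hx) as [s Hs]. rewrite Hs. simpl. f_equal.
    apply valuation_sort. exact Hs.
  - split; intros x Hx; simpl;
      destruct (excluded_middle_informative _); tauto.
Qed.

Definition id_substitution : substitution S :=
  Substitution (Var S) (fun _ => I) (fun _ => eq_refl).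

End Terms.

(** * Evaluation and constraints *)

Section Semantics.
Variables (S : signature) (M : model S).
Implicit Types (t u : term S) (A B : ecterm S) (rho : rule S).
Implicit Types (e xi : valuation S) (sigma tau gamma : substitution S).

(** Two valuations and two substitutions vary at once, since the guards of two steps from different
    terms are to be compared. *)
Lemma eval_apply_ext e e' (g h : var S -> term S) t :
  (forall x, In x (vars t) -> eval M e (g x) = eval M e' (h x)) ->
  eval M e (apply g t) = eval M e' (apply h t).
Proof.
  induction t as [x | f ts IH] using term_nested_ind; simpl; intros H; [auto|].
  destruct f; try reflexivity. f_equal. rewrite !map_map.
  rewrite Forall_forall in IH. apply map_ext_in. intros u Hu.
  apply IH; [exact Hu|]. intros x Hx. apply H, in_flat_map. eauto.
Qed.

Lemma eval_apply e e' (g : var S -> term S) t :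
  (forall x, In x (vars t) -> eval M e (g x) = e' x) ->
  eval M e (apply g t) = eval M e' t.
Proof.
  intros H. rewrite <- (apply_Var t) at 2. apply eval_apply_ext. exact H.
Qed.

Lemma eval_ext e e' t :
  (forall x, In x (vars t) -> e x = e' x) -> eval M e t = eval M e' t.
Proof.
  intros H. rewrite <- (apply_Var t) at 1. apply eval_apply. exact H.
Qed.

(** [interp_and] speaks only about arguments of sort [bool_sort]; this discharges those conditions
    for constraints. *)
Lemma eval_sort e t s :
  well_sorted t -> no_term_symbol t -> term_sort_of t = ThSort _ s ->
  value_sort S (eval M e t) = s.
Proof.
  revert s. induction t as [x | f ts IH] using term_nested_ind; intros s Hw Hn Hs.
  - apply valuation_sort. exact Hs.
  - apply well_sorted_App in Hw as [E Hw].
    apply no_term_symbol_App in Hn as [Hf Hn].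
    destruct f as [w | k | k]; [| | contradiction]; simpl in *.
    + injection Hs as <-. reflexivity.
    + injection Hs as <-. apply interp_sort. rewrite map_map.
      revert E. generalize (theory_arity S k) as ss.
      induction ts as [|t ts IHts]; intros [|s ss] E; try discriminate;
        [reflexivity|].
      simpl in *. injection E as Et Es.
      apply Forall_cons_iff in IH as [IHt IH].
      apply Forall_cons_iff in Hw as [Hwt Hw].
      apply Forall_cons_iff in Hn as [Hnt Hn].
      f_equal; auto.
Qed.

Lemma holds_conj e t u :
  logical_constraint t -> logical_constraint u ->
  (holds M e (conj_constraint t u) <-> holds M e t /\ holds M e u).
Proof.
  intros (Ht & Hts & Htn) (Hu & Hus & Hun).
  apply interp_and; apply eval_sort; assumption.
Qed.

Lemma logical_constraint_conj t u :
  logical_constraint t -> logical_constraint u ->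
  logical_constraint (conj_constraint t u).
Proof.
  intros (Ht & Hts & Htn) (Hu & Hus & Hun). repeat split; simpl; auto.
  - rewrite Hts, Hus, sym_and_arity. reflexivity.
  - rewrite sym_and_result. reflexivity.
Qed.

Lemma logical_constraint_vars t x :
  logical_constraint t -> In x (vars t) -> theory_var S x.
Proof. intros (Hw & Hs & Hn). exact (theory_term_vars _ Hw Hn Hs x). Qed.

Lemma logical_constraint_apply sigma t :
  logical_constraint t ->
  (forall x, In x (vars t) -> no_term_symbol (sigma x)) ->
  logical_constraint (apply sigma t).
Proof.
  intros (Hw & Hs & Hn) H. repeat split.
  - apply well_sorted_apply. exact Hw.
  - rewrite term_sort_of_apply; [exact Hs|]. intros x _. apply sub_sort.
  - apply no_term_symbol_apply; assumption.
Qed.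

(** Substituting values for the bound variables amounts to changing the valuation at them. Their
    theory sorts make the values of [e] admissible witnesses. *)
Lemma ex_holds_iff xi (c : econstr S) :
  (forall x, In x (ex_vars c) -> theory_var S x) ->
  (ex_holds M xi c <->
   exists e, (forall x, ~ In x (ex_vars c) -> e x = xi x) /\
             holds M e (ex_body c)).
Proof.
  intros Hth. unfold ex_holds, holds. split.
  - intros (w & Hw & H).
    unshelve eexists (Valuation
      (fun x => if in_dec (var_eq_dec S) x (ex_vars c) then w x else xi x) _).
    { intros x s Hs. simpl. destruct (in_dec _ _ _) as [Hx|].
      - apply Hw in Hx. congruence.
      - apply valuation_sort. exact Hs. }
    split; simpl.
    + intros x Hx. destruct (in_dec _ _ _); tauto.
    + rewrite <- H. symmetry. apply eval_apply. intros x _. simpl.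
      unfold assign. destruct (in_dec _ _ _); reflexivity.
  - intros (e & He & H). exists e. split.
    + intros x Hx. destruct (Hth x Hx) as [s Hs]. rewrite Hs. f_equal.
      symmetry. apply valuation_sort. exact Hs.
    + rewrite <- H. apply eval_apply. intros x _.
      unfold assign. destruct (in_dec _ _ _); [reflexivity|].
      simpl. symmetry. auto.
Qed.

(** * Instances of constrained terms *)

Lemma ec_bound_theory A x :
  In x (ex_vars (ec_constr A)) -> theory_var S x.
Proof.
  intros Hx. destruct (ec_is_econstr A) as [Hl Hi].
  exact (logical_constraint_vars _ Hl (Hi x Hx)).
Qed.

Lemma ec_logical_free A x :
  ec_logical A x -> ~ In x (ex_vars (ec_constr A)).
Proof. intros Hx Hb. exact (ec_bound_fresh A x Hb (ec_logical_term A x Hx)). Qed.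

(* A single valuation [e] of free and bound variables alike replaces the
   pair of a substitution satisfying the constraint and its witnesses. *)
Definition instance A (sigma : var S -> term S) e : Prop :=
  (forall x, ec_logical A x -> sigma x = val S (e x)) /\
  holds M e (ex_body (ec_constr A)).

(** Forward, validity is used at a valuation that agrees with [sigma] on the logical variables, and
    the witnesses are merged into it. Backward, only bound variables remain in the constraint after
    [sigma], so the choice of valuation is immaterial. *)
Lemma instance_iff (d : valuation S) A sigma :
  (valued (ec_logical A) sigma /\ satisfies M sigma (ec_constr A) <->
   exists e, instance A sigma e).
Proof.
  pose proof (ec_bound_theory A) as Hth. split.
  - intros (Hv & _ & H).
    (* [d] is the default wherever [sigma] does not yield a value. *)
    unshelve epose (xi := Valuation (fun x => match sigma x with
      | App (ValSym _ v) [] => v | _ => d x end) _).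
    { intros x s Hs. simpl. pose proof (valuation_sort d x Hs) as Hd.
      pose proof (sub_sort sigma x) as Hx.
      destruct (sigma x) as [|[v | |] [|]]; auto.
      rewrite Hs in Hx. injection Hx as Hx. exact Hx. }
    assert (forall x, ec_logical A x -> sigma x = val S (xi x)) as Hxi.
    { intros x Hx. destruct (Hv x Hx) as [v E]. simpl. rewrite E. reflexivity. }
    destruct (proj1 (ex_holds_iff xi (ex_apply sigma (ec_constr A)) Hth) (H xi))
      as (e & He & Hb).
    simpl ex_vars in He. exists e. split.
    + intros x Hx. rewrite Hxi, He; auto. apply ec_logical_free. exact Hx.
    + unfold holds in *. rewrite <- Hb. symmetry. apply eval_apply. intros x Hx.
      destruct (in_dec _ _ _) as [|Hf]; [reflexivity|].
      rewrite Hxi by (apply ec_fvar_logical; split; assumption).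
      symmetry. apply He. exact Hf.
  - intros (e & He & Hb).
    assert (valued (ec_logical A) sigma) as Hv
      by (intros x Hx; exists (e x); auto).
    repeat split; [exact Hv | intros x Hx; apply Hv, ec_fvar_logical, Hx |].
    intros xi. apply ex_holds_iff; [exact Hth|]. simpl ex_vars.
    destruct (valuation_splice (fun x => In x (ex_vars (ec_constr A))) e xi)
      as (e' & He1 & He2).
    exists e'. split; [exact He2|].
    unfold holds in *. rewrite <- Hb. apply eval_apply. intros x Hx.
    destruct (in_dec _ _ _) as [Hb'|Hf]; [apply He1; exact Hb'|].
    rewrite He by (apply ec_fvar_logical; split; assumption). reflexivity.
Qed.

(** Yields the [tau] of the overview: being the identity off the logical variables is what makes it
    [flat]. *)
Lemma ground_instance A e : exists sigma,
  (forall x, ec_logical A x -> sigma x = val S (e x)) /\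
  (forall x, ~ ec_logical A x -> sigma x = Var S x).
Proof.
  exact (substitution_ground (ec_logical A) e (id_substitution S)
           (ec_logical_theory A)).
Qed.

Lemma subsumed_instance A B sigma e :
  subsumed M A B -> instance A sigma e ->
  exists tau e', instance B tau e' /\
    apply sigma (ec_term A) = apply tau (ec_term B).
Proof.
  intros HAB Hi.
  destruct (proj2 (instance_iff e A sigma) (ex_intro _ e Hi)) as [Hv Hs].
  destruct (HAB sigma Hv Hs) as (tau & Hv' & Hs' & E).
  destruct (proj1 (instance_iff e B tau) (conj Hv' Hs')) as [e' Hi'].
  eauto.
Qed.

(** * Redexes and contracta *)

Definition redex rho A p gamma : Prop :=
  apart rho A /\
  (forall x, ~ In x (vars (rl_lhs rho)) -> gamma x = Var S x) /\
  subterm_at (ec_term A) p = Some (apply gamma (rl_lhs rho)) /\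
  (forall x, In x (vars (rl_lhs rho)) -> rl_logical rho x ->
     is_val (gamma x) \/ exists y, ec_logical A y /\ gamma x = Var S y).

(** The conditions of [mg_step] are split into matching ([redex]) and result ([contractum]); the
    entailment of the guard and the list of bound variables are established separately. *)
Definition contractum rho A p gamma A' : Prop :=
  ec_term A' = replace_at (ec_term A) p (apply gamma (rl_rhs rho)) /\
  ex_body (ec_constr A') =
    conj_constraint (ex_body (ec_constr A)) (apply gamma (rl_guard rho)) /\
  (forall y, ec_logical A' y <->
     exvar rho y \/ (ec_logical A y /\ In y (vars (ec_term A')))).

Lemma in_vars_rename (d d' : var S -> var S) t :
  (forall x, d' (d x) = x) ->
  forall x, In x (vars t) <-> In (d x) (vars (apply (fun x => Var S (d x)) t)).
Proof.
  intros H x. rewrite vars_rename. split; [apply in_map|].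
  intros (y & E & Hy)%in_map_iff. rewrite <- (H x), <- E, H. exact Hy.
Qed.

Lemma rename_inverse (d d' : var S -> var S) t :
  (forall x, d' (d x) = x) ->
  apply (fun x => Var S (d' x)) (apply (fun x => Var S (d x)) t) = t.
Proof.
  intros H. rewrite apply_apply. rewrite <- (apply_Var t) at 2.
  apply apply_eq_iff. intros x _. simpl. rewrite H. reflexivity.
Qed.

(** Lets one inclusion lemma serve both directions of the final equivalence. *)
Lemma variant_sym rho rho' : variant rho rho' -> variant rho' rho.
Proof.
  intros (d & d' & H1 & H2 & Hs & El & Er & Eg & Hl).
  exists d', d. rewrite El, Er, Eg, !rename_inverse by exact H1.
  repeat split; auto.
  - intros x. rewrite <- (H2 x) at 2. symmetry. apply Hs.
  - rewrite <- (H2 x) at 2. apply Hl.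
  - rewrite <- (H2 x) at 1. apply Hl.
Qed.

Lemma redex_vars rho A p gamma x y :
  redex rho A p gamma -> In x (vars (rl_lhs rho)) -> In y (vars (gamma x)) ->
  In y (vars (ec_term A)).
Proof.
  intros (_ & _ & Hp & _) Hx Hy. apply (subterm_at_vars _ _ _ Hp).
  apply in_vars_apply. eauto.
Qed.

Lemma guard_logical rho x : In x (vars (rl_guard rho)) -> rl_logical rho x.
Proof. intros Hx. apply rl_extra_logical. auto. Qed.

(** Guard variables are logical, hence matched by values or variables, or left alone; no term symbol
    enters the guard. *)
Lemma redex_guard_constraint rho A p gamma :
  redex rho A p gamma -> logical_constraint (apply gamma (rl_guard rho)).
Proof.
  intros (_ & Hid & _ & Hlog).
  apply logical_constraint_apply; [apply rl_guard_constraint|].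
  intros x Hx. destruct (in_dec (var_eq_dec S) x (vars (rl_lhs rho))) as [Hxl|Hxl].
  - destruct (Hlog x Hxl (guard_logical _ _ Hx)) as [[v ->] | (y & _ & ->)];
      simpl; auto.
  - rewrite Hid by exact Hxl. exact I.
Qed.

(** Equal instances of the two terms have equal subterms at [p], and these are instances of one
    left-hand side up to [d]. *)
Lemma redex_align rho rho' A B p gamma gamma' 
    (sigma tau : var S -> term S) (d : var S -> var S) x :
  redex rho A p gamma -> redex rho' B p gamma' ->
  rl_lhs rho' = apply (fun x => Var S (d x)) (rl_lhs rho) ->
  apply sigma (ec_term A) = apply tau (ec_term B) ->
  In x (vars (rl_lhs rho)) ->
  apply sigma (gamma x) = apply tau (gamma' (d x)).
Proof.
  intros (_ & _ & HA & _) (_ & _ & HB & _) El E.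
  apply (subterm_at_apply sigma) in HA. apply (subterm_at_apply tau) in HB.
  rewrite E, HB in HA. injection HA as HA.
  rewrite El, !apply_apply in HA. symmetry in HA. simpl in HA.
  revert x. apply apply_eq_iff. exact HA.
Qed.

(** At logical variables of the rule, [sigma] and [tau] turn both matched images into values, so
    equality of terms becomes equality of evaluations. *)
Lemma redex_eval rho rho' A B p gamma gamma' sigma tau e e'
    (d : var S -> var S) x :
  redex rho A p gamma -> redex rho' B p gamma' ->
  rl_lhs rho' = apply (fun x => Var S (d x)) (rl_lhs rho) ->
  (forall x, rl_logical rho' (d x) <-> rl_logical rho x) ->
  (forall y, ec_logical A y -> sigma y = val S (e y)) ->
  (forall y, ec_logical B y -> tau y = val S (e' y)) ->
  apply sigma (ec_term A) = apply tau (ec_term B) ->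
  In x (vars (rl_lhs rho)) -> rl_logical rho x ->
  eval M e (gamma x) = eval M e' (gamma' (d x)).
Proof.
  intros HrA HrB El Hl HA HB E Hx Hlx.
  pose proof (redex_align _ _ _ _ HrA HrB El E Hx) as Ex.
  destruct HrA as (_ & _ & _ & HlA), HrB as (_ & _ & _ & HlB).
  assert (In (d x) (vars (rl_lhs rho'))) as Hdx
    by (rewrite El, vars_rename; apply in_map; exact Hx).
  destruct (HlA x Hx Hlx) as [[v Ev] | (y & Hy & Ev)];
  destruct (HlB (d x) Hdx (proj2 (Hl x) Hlx)) as [[w Ew] | (z & Hz & Ew)];
  rewrite Ev, Ew in *; simpl in *; rewrite ?(HA _ Hy), ?(HB _ Hz) in Ex;
  injection Ex as Ex; exact Ex.
Qed.

(** An instance of [A'] is extended back to one of [A], moved to [B] by subsumption, and completed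
    on the variables of [rho'] to an instance of [B']. *)
Lemma contractum_subsumed rho rho' A B p gamma gamma' A' B' :
  satisfiable M A -> variant rho rho' ->
  redex rho A p gamma -> contractum rho A p gamma A' ->
  redex rho' B p gamma' -> contractum rho' B p gamma' B' ->
  subsumed M A B -> subsumed M A' B'.
Proof.
  intros [xi _] (d & d' & Hd1 & Hd2 & Hds & El & Er & Eg & Hl)
    HrA (EtA & EbA & HlA) HrB (EtB & EbB & HlB) HAB sigma Hv Hs.
  pose proof HrA as (HaA & HidA & HpA & HvA).
  pose proof HrB as (HaB & HidB & HpB & HvB).
  destruct (proj1 (instance_iff xi A' sigma) (conj Hv Hs)) as (e & He & Hb).
  rewrite EbA in Hb.
  pose proof (in_vars_rename d d' (rl_lhs rho) Hd1) as Hlhs.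
  pose proof (in_vars_rename d d' (rl_rhs rho) Hd1) as Hrhs.
  rewrite <- El in Hlhs. rewrite <- Er in Hrhs.
  pose proof (redex_guard_constraint HrA) as HgA.
  pose proof (redex_guard_constraint HrB) as HgB.
  apply holds_conj in Hb as [Hphi Hpi];
    [| apply (ec_is_econstr A) | exact HgA].
  (* A logical variable of [A] that vanishes from [A'] need not be mapped to a value by [sigma];
     [sigma'] takes its value from [e]. *)
  destruct (substitution_ground (ec_logical A) e sigma (ec_logical_theory A))
    as (sigma' & Hs1 & Hs2).
  destruct (subsumed_instance sigma' (e := e) HAB)
    as (tau & eB & [HtB HbB] & E); [split; assumption|].
  (* [sigma] and [e] transported along the renaming, for use on the variables of [rho']. *)
  unshelve epose (sd := Substitution (fun y => sigma (d' y)) _ _).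
  { intros y. apply sub_well_sorted. }
  { intros y. simpl. rewrite sub_sort, <- Hds, Hd2. reflexivity. }
  unshelve epose (ed := Valuation (fun y => e (d' y)) _).
  { intros y s Hy. simpl. apply valuation_sort.
    rewrite <- Hds, Hd2. exact Hy. }
  destruct (substitution_splice (rule_var rho') sd tau) as (tau' & Ht1 & Ht2).
  destruct (valuation_splice (rule_var rho') ed eB) as (e' & He1 & He2).
  (* [rho'] is apart from [B], so overwriting its variables leaves the instance of [B] intact. *)
  assert (forall y, In y (vars (ec_term B)) -> tau' y = tau y) as Htau.
  { intros y Hy. apply Ht2. intros Hr. exact (proj1 (HaB y Hr) Hy). }
  assert (forall y, ec_logical B y -> e' y = eB y) as HeB.
  { intros y Hy. apply He2. intros Hr.
    exact (proj1 (HaB y Hr) (ec_logical_term B y Hy)). }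
  assert (apply tau (ec_term B) = apply tau' (ec_term B)) as Etau
    by (apply apply_eq_iff; intros y Hy; symmetry; auto).
  rewrite Etau in E.
  assert (forall y, ec_logical B y -> tau' y = val S (e' y)) as HtB'.
  { intros y Hy. rewrite Htau, HeB by auto using ec_logical_term. auto. }
  exists tau'. apply and_assoc. split.
  - apply (instance_iff xi). exists e'. split.
    + intros y [[Hy Hny] | [Hy _]]%HlB; [|auto].
      assert (rule_var rho' y) as Hr by (unfold rule_var; auto).
      rewrite Ht1, He1 by exact Hr. simpl. apply He, HlA. left.
      rewrite <- (Hd2 y) in Hy, Hny. split; [apply Hrhs, Hy|].
      intros H. apply Hny, Hlhs, H.
    + rewrite EbB. apply holds_conj; [apply (ec_is_econstr B) | exact HgB |].
      split; unfold holds in *.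
      * rewrite <- HbB. apply eval_ext. intros y Hy. apply He2.
        intros Hr. exact (proj2 (HaB y Hr) Hy).
      * rewrite <- Hpi. rewrite Eg, apply_apply. symmetry.
        apply eval_apply_ext. intros x Hx. simpl.
        destruct (in_dec (var_eq_dec S) x (vars (rl_lhs rho))) as [Hxl|Hxl].
        -- exact (redex_eval sigma' tau' e e' d x HrA HrB El Hl Hs1 HtB' E Hxl (guard_logical _ _ Hx)).
        -- rewrite HidA, HidB by (rewrite <- ?Hlhs; exact Hxl). simpl.
           rewrite He1; [simpl; rewrite Hd1; reflexivity|].
           right. right. rewrite Eg, vars_rename. apply in_map. exact Hx.
  - transitivity (apply sigma' (ec_term A')).
    (* A logical variable of [A] that still occurs in [A'] is logical there, so [sigma] already
       gives it its value from [e]. *)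
    + apply apply_eq_iff. intros x Hx.
      destruct (classic (ec_logical A x)) as [HX|HX].
      * rewrite Hs1 by exact HX. apply He, HlA. auto.
      * symmetry. auto.
    + rewrite EtA, EtB, (replace_at_apply _ _ _ _ HpA),
        (replace_at_apply _ _ _ _ HpB), E.
      f_equal. rewrite Er, !apply_apply. apply apply_eq_iff. intros x Hx. simpl.
      destruct (in_dec (var_eq_dec S) x (vars (rl_lhs rho))) as [Hxl|Hxl].
      * exact (redex_align _ _ _ _ HrA HrB El E Hxl).
      (* An extra variable of the rule does not occur in [A], so [sigma'] and [sigma] agree on
         it. *)
      * rewrite HidA, HidB by (rewrite <- ?Hlhs; exact Hxl). simpl.
        rewrite Hs2, Ht1; [simpl; rewrite Hd1; reflexivity | |].
        -- right. left. apply Hrhs, Hx.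
        -- intros HX. apply (proj1 (HaA x (or_intror (or_introl Hx)))).
           apply ec_logical_term. exact HX.
Qed.

(** * Existence of the corresponding step *)

Lemma satisfiable_witness A :
  satisfiable M A -> exists e, holds M e (ex_body (ec_constr A)).
Proof.
  intros (xi & H). apply ex_holds_iff in H as (e & _ & He);
    [eauto | apply ec_bound_theory].
Qed.

Lemma redex_transfer rho rho' A B p gamma :
  satisfiable M B -> variant rho rho' ->
  left_value_free rho -> apart rho' B -> subsumed M B A ->
  redex rho A p gamma ->
  exists gamma', redex rho' B p gamma' /\
    (forall x, in_dom gamma' x <-> In x (vars (rl_lhs rho'))).
Proof.
  intros HB (d & d' & Hd1 & Hd2 & Hds & El & _ & _ & Hl) [Hlin Hval] HaB HBA
    (_ & _ & Hp & Hlog).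
  destruct (satisfiable_witness HB) as [e He].
  destruct (ground_instance B e) as (tau & Ht1 & Ht2).
  assert (flat tau) as Hflat.
  { intros y. destruct (classic (ec_logical B y)) as [Hy|Hy]; [left | right; auto].
    exists (e y). auto. }
  destruct (subsumed_instance tau (e := e) HBA)
    as (sigma & eA & [HsA _] & E); [split; assumption|].
  symmetry in E.
  destruct (subterm_at_flat _ _ _ _ Hflat E Hp) as (v & Hv & Ev).
  rewrite apply_apply in Ev.
  destruct (linear_match_flat _ _ Hflat Hlin Hval Ev) as [k Hk].
  assert (forall x, In x (vars (rl_lhs rho)) ->
    apply sigma (gamma x) = apply tau (k x)) as Hx.
  { apply apply_eq_iff. rewrite <- (apply_apply tau k), Hk. exact Ev. }
  assert (well_sorted v) as Hwv
    by exact (subterm_at_well_sorted _ _ Hv (ec_well_sorted B)).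
  assert (forall y, In y (vars (rl_lhs rho')) -> In (d' y) (vars (rl_lhs rho)))
    as Hlhs.
  { intros y. rewrite El, vars_rename. intros (x & <- & Hx')%in_map_iff.
    rewrite Hd1. exact Hx'. }
  unshelve epose (gamma' := Substitution (fun y =>
    if in_dec (var_eq_dec S) y (vars (rl_lhs rho')) then k (d' y)
    else Var S y) _ _).
  { intros y. simpl. destruct (in_dec _ _ _) as [Hy|]; [|exact I].
    rewrite <- Hk in Hwv. apply (well_sorted_apply_inv _ _ _ Hwv). auto. }
  { intros y. simpl. destruct (in_dec _ _ _) as [Hy|]; [|reflexivity].
    (* [tau] preserves sorts, so the sort of [k (d' y)] is computed on the other side of the common
       instance, from [gamma]. *)
    rewrite <- (term_sort_of_apply tau), <- Hx, term_sort_of_apply, sub_sort;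
      auto using sub_sort.
    rewrite <- Hds, Hd2. reflexivity. }
  assert (apply gamma' (rl_lhs rho') = v) as Hv'.
  { rewrite <- Hk, El, apply_apply. apply apply_eq_iff. intros x Hx'. simpl.
    destruct (in_dec _ _ _) as [|Hn]; [rewrite Hd1; reflexivity|].
    exfalso. apply Hn. rewrite El, vars_rename. apply in_map. exact Hx'. }
  assert (forall y, In y (vars (rl_lhs rho')) -> gamma' y = k (d' y)) as Hg.
  { intros y Hy. simpl. destruct (in_dec _ _ _); tauto. }
  assert (forall y, ~ In y (vars (rl_lhs rho')) -> gamma' y = Var S y) as Hid.
  { intros y Hy. simpl. destruct (in_dec _ _ _); tauto. }
  clearbody gamma'. exists gamma'. split.
  - split; [exact HaB|]. split; [exact Hid|]. rewrite Hv'. split; [exact Hv|].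
    intros y Hy Hly. rewrite Hg by exact Hy.
    rewrite <- (Hd2 y), Hl in Hly. apply Hlhs in Hy.
    assert (is_val (apply sigma (gamma (d' y)))) as [w Ew].
    { destruct (Hlog _ Hy Hly) as [[w Ew] | (z & Hz & Ez)].
      - rewrite Ew. exists w. reflexivity.
      - rewrite Ez. exists (eA z). apply HsA. exact Hz. }
    (* Only a value or a logical variable of [B] can become a value under [tau]. *)
    rewrite Hx in Ew by exact Hy. destruct (k (d' y)) as [z | f ts].
    + destruct (classic (ec_logical B z)) as [Hz|Hz]; [eauto|].
      simpl in Ew. rewrite Ht2 in Ew by exact Hz. discriminate.
    + injection Ew as -> Ew. left. exists w.
      destruct ts; [reflexivity | discriminate].
  - intros y. split.
    + intros Hy. apply NNPP. intros Hn. apply Hy, Hid, Hn.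
    (* If [gamma'] fixed [y], then [y] would occur in [B], against apartness. *)
    + intros Hy Eg. apply (proj1 (HaB y (or_introl Hy))).
      apply (subterm_at_vars _ _ _ Hv). rewrite <- Hv'.
      apply in_vars_apply. exists y. split; [exact Hy|].
      rewrite Eg. left. reflexivity.
Qed.

(** A model of the constraint of [B] yields an instance of [B], thence one of [A]; the entailment
    assumed there supplies values for the extra guard variables, which are transported along the
    renaming. *)
Lemma guard_entailed rho rho' A B p gamma gamma' zs zs' :
  variant rho rho' -> subsumed M B A -> redex rho A p gamma -> redex rho' B p gamma' ->
  (forall z, In z zs <->
     In z (vars (rl_guard rho)) /\ ~ In z (vars (rl_lhs rho))) ->
  (forall z, In z zs' <->
     In z (vars (rl_guard rho')) /\ ~ In z (vars (rl_lhs rho'))) ->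
  ex_entails M (ec_constr A) (EConstr zs (apply gamma (rl_guard rho))) ->
  ex_entails M (ec_constr B) (EConstr zs' (apply gamma' (rl_guard rho'))).
Proof.
  intros (d & d' & Hd1 & Hd2 & Hds & El & _ & Eg & Hl) HBA HrA HrB
    Hz Hz' Hent xi Hxi.
  pose proof HrA as (HaA & HidA & HpA & HvA).
  pose proof HrB as (HaB & HidB & HpB & HvB).
  apply ex_holds_iff in Hxi as (eB & HeB & HbB); [|apply ec_bound_theory].
  destruct (ground_instance B eB) as (tau & Ht1 & Ht2).
  destruct (subsumed_instance tau (e := eB) HBA)
    as (sigma & eA & [HsA HbA] & E); [split; assumption|].
  symmetry in E.
  (* [eA] already contains suitable values of the bound variables, so it is its own witness. *)
  assert (ex_holds M eA (ec_constr A)) as Hex.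
  { apply ex_holds_iff; [apply ec_bound_theory|]. exists eA. auto. }
  apply Hent, ex_holds_iff in Hex as (e1 & He1 & Hg); simpl in *;
    [|intros z [Hzg _]%Hz; exact (rl_logical_theory _ _ (guard_logical _ _ Hzg))].
  apply ex_holds_iff; simpl;
    [intros z [Hzg _]%Hz'; exact (rl_logical_theory _ _ (guard_logical _ _ Hzg))|].
  unshelve epose (ed := Valuation (fun y => e1 (d' y)) _).
  { intros y s Hy. simpl. apply valuation_sort. rewrite <- Hds, Hd2. exact Hy. }
  (* Outside [zs'] the witness must be [xi]; on the logical variables of [B] this agrees with [eB],
     as they are not bound. *)
  destruct (valuation_splice (fun y => In y zs') ed xi) as (e' & He'1 & He'2).
  exists e'. split; [exact He'2|].
  unfold holds in *. rewrite <- Hg, Eg, apply_apply. symmetry.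
  apply eval_apply_ext. intros x Hx. simpl.
  assert (In (d x) (vars (rl_guard rho'))) as Hdx
    by (rewrite Eg, vars_rename; apply in_map; exact Hx).
  pose proof (in_vars_rename d d' (rl_lhs rho) Hd1 x) as Hlhs.
  rewrite <- El in Hlhs.
  destruct (in_dec (var_eq_dec S) x (vars (rl_lhs rho))) as [Hxl|Hxl].
  - refine (redex_eval sigma tau e1 e' d x HrA HrB El Hl _ _ E Hxl (guard_logical _ _ Hx)).
    + intros y Hy. rewrite HsA by exact Hy. rewrite He1; [reflexivity|].
      intros [Hyg _]%Hz. apply (proj1 (HaA y (or_intror (or_intror Hyg)))).
      apply ec_logical_term. exact Hy.
    + intros y Hy. rewrite Ht1 by exact Hy. rewrite He'2, HeB;
        [reflexivity | apply ec_logical_free; exact Hy |].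
      intros [Hyg _]%Hz'. apply (proj1 (HaB y (or_intror (or_intror Hyg)))).
      apply ec_logical_term. exact Hy.
  - rewrite HidA, HidB by (rewrite <- ?Hlhs; exact Hxl). simpl.
    rewrite He'1; [simpl; rewrite Hd1; reflexivity|].
    apply Hz'. split; [exact Hdx|]. rewrite <- Hlhs. exact Hxl.
Qed.

(** The content lies in the side conditions of [ecterm]; apartness keeps the variables of the rule
    separate from those of [A]. *)
Lemma contractum_exists rho A p gamma :
  redex rho A p gamma ->
  exists A', contractum rho A p gamma A' /\
    (forall y, In y (ex_vars (ec_constr A')) <->
       In y (vars (ex_body (ec_constr A'))) /\ ~ In y (vars (ec_term A'))).
Proof.
  intros Hr. pose proof Hr as (Ha & Hid & Hp & Hlog).
  set (t' := replace_at (ec_term A) p (apply gamma (rl_rhs rho))).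
  set (b := conj_constraint (ex_body (ec_constr A)) (apply gamma (rl_guard rho))).
  set (ys := filter (fun y => if in_dec (var_eq_dec S) y (vars t') then false
                              else true) (vars b)).
  assert (forall y, In y ys <-> In y (vars b) /\ ~ In y (vars t')) as Hys.
  { intros y. unfold ys. rewrite filter_In.
    destruct (in_dec _ _ _); intuition discriminate. }
  (* Images of left-hand side variables contain only variables of [A], so a rule variable present in
     [t'] is an extra one. *)
  assert (forall y, In y (vars t') -> rule_var rho y -> exvar rho y) as Hex.
  { intros y Hy Hry. destruct (Ha y Hry) as [Hn _].
    apply replace_at_vars in Hy as [Hy | Hy]; [contradiction|].
    apply in_vars_apply in Hy as (x & Hx & Hy).
    destruct (in_dec (var_eq_dec S) x (vars (rl_lhs rho))) as [Hxl|Hxl].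
    - exfalso. exact (Hn (redex_vars _ _ Hr Hxl Hy)).
    - rewrite Hid in Hy by exact Hxl. destruct Hy as [<- | []].
      split; assumption. }
  assert (forall y, In y (vars t') ->
    rule_var rho y \/ In y (vars (ec_term A))) as Ht'.
  { intros y Hy. apply replace_at_vars in Hy as [Hy | Hy]; [auto|].
    apply in_vars_apply in Hy as (x & Hx & Hy).
    destruct (in_dec (var_eq_dec S) x (vars (rl_lhs rho))) as [Hxl|Hxl].
    - right. exact (redex_vars _ _ Hr Hxl Hy).
    - rewrite Hid in Hy by exact Hxl. destruct Hy as [<- | []].
      left. right. left. exact Hx. }
  unshelve eexists (@ECTerm S (fun y => exvar rho y \/
      (ec_logical A y /\ In y (vars t'))) t' (EConstr ys b) _ _ _ _ _ _).
  - eapply replace_at_well_sorted; [exact Hp | apply ec_well_sorted | |].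
    + apply well_sorted_apply, rl_rhs_well_sorted.
    + rewrite !term_sort_of_apply by (intros; apply sub_sort).
      symmetry. apply rl_same_sort.
  - split; simpl; [|intros y Hy; apply Hys, Hy].
    apply logical_constraint_conj; [apply (ec_is_econstr A)|].
    exact (redex_guard_constraint Hr).
  - intros y [[Hy Hn] | [Hy _]]; [|apply (ec_logical_theory A y Hy)].
    apply (rl_logical_theory rho), rl_extra_logical. auto.
  (* A free variable of the new constraint occurs in [t']. Coming from [A], it is free there, since
     a bound one cannot enter [t']; coming from the guard, it is a logical variable of [A] or an
     extra variable. *)
  - intros y [Hy Hny]. simpl in Hy, Hny.
    assert (In y (vars t')) as Hyt.
    { apply NNPP. intros Hn. apply Hny, Hys. auto. }
    simpl in Hy. rewrite app_nil_r in Hy. apply in_app_iff in Hy as [Hy | Hy].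
    + right. split; [|exact Hyt].
      apply ec_fvar_logical. split; [exact Hy|]. intros Hb.
      destruct (Ht' y Hyt) as [Hry | HyA].
      * exact (proj2 (Ha y Hry) Hy).
      * exact (ec_bound_fresh A y Hb HyA).
    + apply in_vars_apply in Hy as (x & Hx & Hy).
      destruct (in_dec (var_eq_dec S) x (vars (rl_lhs rho))) as [Hxl|Hxl].
      * destruct (Hlog x Hxl (guard_logical _ _ Hx)) as [[v E] | (z & Hz & E)];
          rewrite E in Hy; [destruct Hy | destruct Hy as [<- | []]; auto].
      * rewrite Hid in Hy by exact Hxl. destruct Hy as [<- | []].
        left. apply Hex; [exact Hyt|]. right. right. exact Hx.
  - intros y [[Hy Hn] | [_ Hy]]; [|exact Hy].
    eapply replace_at_vars_new; [exact Hp|]. apply in_vars_apply.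
    exists y. split; [exact Hy|]. rewrite Hid by exact Hn. left. reflexivity.
  - intros y Hy. apply Hys, Hy.
  - split; [|exact Hys]. repeat split; simpl; auto.
Qed.

End Semantics.

(* Rules are used renamed apart: [rho'] is any renaming of [rho] whose variables
   do not occur in [B]; [rho] itself qualifies when it is apart from [B]. *)
Theorem mainTheorem7 (S : signature) (M : model S) (rho rho' : rule S)
    (A A' B : ecterm S)
    (Hrho : left_value_free rho)
    (HA : satisfiable M A) (HB : satisfiable M B)
    (Hstep : mg_step M rho A A')
    (Hequiv : equivalent M A B)
    (Hvariant : variant rho rho') (Hapart : apart rho' B) :
  exists B' : ecterm S, mg_step M rho' B B' /\ equivalent M A' B'.
Proof.
  destruct Hstep as (_ & _ & HaA & p & gamma & zs & Hdom & Hp & Hlog & Hzs &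
    Hent & Et & Eb & _ & HlA').
  destruct Hequiv as [HAB HBA].
  assert (redex rho A p gamma) as HrA.
  { repeat split; try assumption; try apply HaA; try assumption.
    intros x Hx. apply NNPP. intros Hn. apply Hx, Hdom, Hn. }
  destruct (redex_transfer HB Hvariant Hrho Hapart HBA HrA)
    as (gamma' & HrB & Hdom').
  destruct (contractum_exists HrB) as (B' & HcB & Hex).
  assert (contractum rho A p gamma A') as HcA by (split; [|split]; assumption).
  pose (zs' := filter (fun z => if in_dec (var_eq_dec S) z (vars (rl_lhs rho'))
    then false else true) (vars (rl_guard rho'))).
  assert (forall z, In z zs' <->
    In z (vars (rl_guard rho')) /\ ~ In z (vars (rl_lhs rho'))) as Hzs'.
  { intros z. unfold zs'. rewrite filter_In.
    destruct (in_dec _ _ _); intuition discriminate. }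
  exists B'. split; [|split].
  - split; [exact HB|]. split.
    (* Renaming by the injective [d] preserves linearity. *)
    { destruct Hrho as [Hlin _].
      destruct Hvariant as (d & d' & Hd & _ & _ & El & _).
      unfold left_linear, linear. rewrite El, vars_rename.
      apply NoDup_map_NoDup_ForallPairs; [|exact Hlin].
      intros x y _ _ E. rewrite <- (Hd x), E. apply Hd. }
    split; [exact Hapart|].
    pose proof HrB as (_ & _ & HpB & HlogB).
    pose proof HcB as (EtB & EbB & HlB').
    exists p, gamma', zs'. repeat (split; [assumption|]).
    split; [|repeat (split; [assumption|]); assumption].
    exact (guard_entailed _ Hvariant HBA HrA HrB Hzs Hzs' Hent).
  - exact (contractum_subsumed HA Hvariant HrA HcA HrB HcB HAB).
  (* The converse inclusion exchanges the two steps and inverts the renaming. *)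
  - exact (contractum_subsumed HB (variant_sym Hvariant) HrB HcB HrA HcA HBA).
Qed.
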